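(* Let $R$ be any ring and $M$ be a maximal ideal of $R$. Then $R(+)M$ is a maximal subring of $R(+)R$. In particular, $R(+)R$ has maximal subrings for any ring $R$.
   Context: All rings are commutative with nonzero identity, and all subrings are unital. A proper subring $A$ of a ring $B$ is called a maximal subring of $B$ if there is no ring $S$ with $A\subset S\subset B$, where $\subset$ denotes proper inclusion. For a ring $R$ and an $R$-module $E$, the idealization $R(+)E$ is the ring whose additive group is $R\oplus E$ with multiplication $(r_1,e_1)(r_2,e_2)=(r_1r_2,\,r_1e_2+r_2e_1)$. For an ideal $M$ of $R$, $R(+)M$ is regarded as the subring $\{(r,m): r\in R,\ m\in M\}$ of $R(+)R$. *)

(* Defs.v *)
From HB Require Import structures.
From mathcomp Require Import all_boot all_algebra.
From mathcomp Require Import classical_sets.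
Set Implicit Arguments.
Unset Strict Implicit.
Unset Printing Implicit Defensive.
Import GRing.Theory.
Local Open Scope ring_scope.
Local Open Scope classical_set_scope.

(* Arbitrary (not necessarily decidable) subsets are classical sets A : set T;
   [in A] is the associated boolean membership predicate, so that the closure
   predicates of MathComp apply to them.                                      *)

(* idealr_closed I includes 1 \notin I, i.e. it says that I is a proper ideal. *)
Definition maximal_ideal (R : comNzRingType) (M : set R) : Prop :=
  idealr_closed [in M] /\
  forall I : set R, idealr_closed [in I] -> M `<=` I -> I = M.

Definition maximal_subring (B : comNzRingType) (A : set B) : Prop :=
  [/\ GRing.subring_closed [in A], A `<` [set: B] &
      ~ exists S : set B,
          [/\ GRing.subring_closed [in S], A `<` S & S `<` [set: B]]].

(* An alias of R * E: it keeps the additive group of the product, but must not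
   inherit its componentwise multiplication.                                  *)
Definition idealization (R : comNzRingType) (E : lmodType R) : Type :=
  (R * E)%type.

Section IdealizationRing.
Variables (R : comNzRingType) (E : lmodType R).
Local Notation T := (idealization E).

HB.instance Definition _ := GRing.Zmodule.copy T (R * E)%type.

Definition idealization_one : T := (1, 0).
Definition idealization_mul (x y : T) : T :=
  (x.1 * y.1, x.1 *: y.2 + y.1 *: x.2).

Fact idealization_mulA : associative idealization_mul.
Proof.
move=> [a x] [b y] [c z]; rewrite /idealization_mul /= mulrA; congr pair.
by rewrite !scalerDr !scalerA addrA [c * a]mulrC [c * b]mulrC [b * c]mulrC.
Qed.

Fact idealization_mulC : commutative idealization_mul.
Proof. by move=> [a x] [b y]; rewrite /idealization_mul /= mulrC addrC. Qed.

Fact idealization_mul1 : left_id idealization_one idealization_mul.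
Proof.
by move=> [a x]; rewrite /idealization_mul /= mul1r scale1r scaler0 addr0.
Qed.

Fact idealization_mulDl : left_distributive idealization_mul +%R.
Proof.
move=> [a x] [b y] [c z]; rewrite /idealization_mul /= mulrDl; congr pair.
by rewrite scalerDl scalerDr addrACA.
Qed.

Fact idealization_one_neq0 : idealization_one != 0.
Proof. by apply/eqP => -[/eqP]; rewrite oner_eq0. Qed.

HB.instance Definition _ := GRing.Zmodule_isComNzRing.Build T
  idealization_mulA idealization_mulC idealization_mul1
  idealization_mulDl idealization_one_neq0.

End IdealizationRing.

(* R(+)N inside R(+)E, for a subset N of E. *)
Definition idealization_sub (R : comNzRingType) (E : lmodType R) (N : set E) :
  set (idealization E) := [set x | N x.2].

(* Main.v *)
Require Import Defs.
From mathcomp Require Import all_boot all_algebra.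
From mathcomp Require Import boolp classical_sets.
Set Implicit Arguments.
Unset Strict Implicit.
Unset Printing Implicit Defensive.
Import GRing.Theory.
Local Open Scope ring_scope.
Local Open Scope classical_set_scope.

(** Since [(r, e) = (r, 0) + (0, e)], a subring S of the idealization R(+)E that
    contains every [(r, 0)] is determined by its slice [N = {e | (0, e) in S}]:
    it equals R(+)N. The slice is a submodule of E because
    [(r, 0) * (0, e) = (0, r e)]; conversely R(+)N is a subring for every
    submodule N. So the subrings of R(+)E containing R(+)0 correspond to the
    submodules of E ([subring_idealizationE], [slice_submod_closed],
    [idealization_sub_subring]).

    For E = R the submodules are the ideals of R. A ring strictly between R(+)M
    and R(+)R would be R(+)I for an ideal I strictly between M and R, which
    maximality of M forbids. The existence of a maximal subring then reduces to
    the existence of a maximal ideal, obtained from Zorn's lemma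
    ([maximal_ideal_exists]). *)

Section Idealization.
Variables (R : comNzRingType) (E : lmodType R).
Implicit Types (N : set E) (S : set (idealization E)).

Lemma idealization_sub_subring N :
  GRing.submod_closed [in N] -> GRing.subring_closed [in idealization_sub N].
Proof.
move=> [N0 Nlin]; split; first exact: N0.
  move=> x y /set_mem xN /set_mem yN; apply/mem_set => /=.
  rewrite /idealization_sub /= addrC -scaleN1r.
  by apply/set_mem/Nlin; exact: mem_set.
move=> x y /set_mem xN /set_mem yN; apply/mem_set.
apply/set_mem/Nlin; first exact: mem_set.
by rewrite -[_ *: _]addr0; apply: Nlin => //; exact: mem_set.
Qed.

Definition idealization_slice S : set E := [set e | S (0, e)].

(** Closure under scaling is where [(r, 0)] in S enters: the product
    [(a, 0) * (0, u)] is [(0, a *: u)]. *)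
Lemma slice_submod_closed S :
    GRing.subring_closed [in S] -> (forall r, S (r, 0)) ->
  GRing.submod_closed [in idealization_slice S].
Proof.
move=> [_ SB SM] S0; split; first exact/mem_set/S0.
move=> a u v /set_mem uS /set_mem vS; apply/mem_set.
have auS := SM _ _ (mem_set (S0 a)) (mem_set uS).
have NvS := SB _ _ (mem_set (S0 0)) (mem_set vS).
have /set_mem := SB _ _ auS NvS.
rewrite /idealization_slice /=; congr (S _); congr pair => /=.
  by rewrite mulr0 !subr0.
by rewrite scale0r addr0 sub0r opprK.
Qed.

(** Membership of [(r, e)] in S does not depend on r: subtracting the elements
    [(r, 0)] of S moves between [(r, e)] and [(0, e)]. *)
Lemma subring_idealizationE S :
    GRing.subring_closed [in S] -> (forall r, S (r, 0)) ->
  S = idealization_sub (idealization_slice S).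
Proof.
move=> [_ SB _] S0; apply/seteqP; split=> -[r e] reS.
  have /set_mem := SB _ _ (mem_set reS) (mem_set (S0 r)).
  by congr (S _); congr pair; rewrite /= ?subrr ?subr0.
have /set_mem := SB _ _ (mem_set reS) (mem_set (S0 (- r))).
by congr (S _); congr pair; rewrite /= ?sub0r ?opprK ?subr0.
Qed.

End Idealization.

Section Ideals.
Variable R : comNzRingType.
Implicit Types I M : set R.

Lemma maximal_ideal_exists : exists M, maximal_ideal M.
Proof.
(* Zorn's lemma also considers the empty chain, whose union is the empty set, so
   P cannot demand that I contain 0. The remaining closure condition gives it
   for any nonempty I, since 0 = -1 * u + u; and the empty set is not maximal,
   being properly contained in the zero ideal. *)
pose P I := ~ I 1 /\ forall a u v, I u -> I v -> I (a * u + v).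
have chainP (F : set (set R)) : F `<=` P -> total_on F subset ->
    P (\bigcup_(X in F) X).
  move=> FP Ftot; split=> [[X /FP[X1 _] /X1//]|a u v [X FX Xu] [Y FY Yv]].
  have [XY|YX] := Ftot _ _ FX FY.
    by exists Y => //; apply: (FP _ FY).2 => //; exact: XY.
  by exists X => //; apply: (FP _ FX).2 => //; exact: YX.
have [M [[M1 Mlin] Mmax]] := Zorn_bigcup chainP.
have idealP I : idealr_closed [in I] -> P I.
  move=> [_ I1 Ilin]; split; first by move=> /mem_set; exact/negP.
  by move=> a u v Iu Iv; apply/set_mem/Ilin; exact: mem_set.
have max_eq I : idealr_closed [in I] -> M `<=` I -> I = M.
  move=> Iid MI; apply/seteqP; split=> //; apply: contrapT => IM.
  exact: (Mmax _ (conj MI IM) (idealP _ Iid)).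
exists M; split=> //; split.
- apply: mem_set; apply: contrapT => M0.
  have Mempty u : ~ M u.
    by move=> Mu; apply: M0; rewrite -(addNr u) -mulN1r; exact: Mlin.
  apply: (Mmax [set 0]); last first.
    split=> /= [/eqP|a u v -> ->]; first by rewrite oner_eq0.
    by rewrite mulr0 addr0.
  by split=> [u /Mempty//|/(_ 0 erefl)].
- by apply/negP => /set_mem.
- by move=> a u v /set_mem Mu /set_mem Mv; apply/mem_set/Mlin.
Qed.

(** A subring S containing R(+)M contains R(+)0, hence is R(+)I for its slice I,
    which contains M. If S is not everything, I is a proper ideal, so I = M by
    maximality, and S is R(+)M itself. *)
Lemma idealization_sub_maximal M :
  maximal_ideal M -> maximal_subring (idealization_sub (M : set R^o)).
Proof.
move=> [[M0 M1 Mlin] Mmax]; split.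
- by apply: idealization_sub_subring; split.
- split=> // /(_ (0, 1) I) /mem_set; exact/negP.
move=> [S [Ssub [MS SM] [_ ST]]].
have S0 r : S (r, 0) by apply: MS; exact: set_mem M0.
have SE := subring_idealizationE Ssub S0.
have [I0 Ilin] := slice_submod_closed Ssub S0.
have I1 : 1 \notin idealization_slice S.
  (* A slice containing 1 contains every e = e *: 1, so S is everything. *)
  apply/negP => I1; apply: ST => -[r e] _; rewrite SE.
  by apply: set_mem; rewrite -[e]mulr1 -[e * 1]addr0; exact: Ilin.
apply: SM; rewrite SE (Mmax (idealization_slice S)) // => e Me.
exact: MS.
Qed.

End Ideals.

(* R^o is R regarded as a module over itself. *)
Theorem corollary2p6 (R : comNzRingType) :
  (forall M : set R, maximal_ideal M ->
     maximal_subring (idealization_sub (M : set R^o))) /\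
  (exists A : set (idealization R^o), maximal_subring A).
Proof.
split=> [M|]; first exact: idealization_sub_maximal.
have [M /idealization_sub_maximal maxM] := maximal_ideal_exists R.
by exists (idealization_sub (M : set R^o)).
Qed.
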